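(* Suppose that $X$ is a monotonically normal space possessing any one of the following properties: weak Lindelöfness, linear Lindelöfness, or almost discrete Lindelöfness. Then $X$ is Lindelöf.
   Context: All spaces are topological spaces assumed to be $T_1$. For a space $X$, $\tau(X)$ is its topology and $\tau(x,X)=\{U\in\tau(X):x\in U\}$ for $x\in X$. A space is Lindelöf if every open cover has a countable subcover. A space is linearly Lindelöf if every open cover that is linearly ordered by inclusion has a countable subcover. A space $X$ is almost discretely Lindelöf if for any discrete set $D\subset X$ (i.e. $D$ is discrete in its subspace topology) there exists a Lindelöf subspace $L\subset X$ such that $D\subset L$. A space $X$ is weakly Lindelöf if for every open cover $\mathcal{U}$ of $X$ there is a countable $\mathcal{U}'\subset\mathcal{U}$ such that $\bigcup\mathcal{U}'$ is dense in $X$. A space $X$ is monotonically normal if it admits an operator $O$ that assigns to any point $x\in X$ and any $U\in\tau(x,X)$ a set $O(x,U)\in\tau(x,X)$ such that $O(x,U)\subset U$ and, for any points $x,y\in X$ and sets $U,V\in\tau(X)$ with $x\in U$ and $y\in V$, it follows from $O(x,U)\cap O(y,V)\neq\emptyset$ that $x\in V$ or $y\in U$. *)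

(* Defs.v *)
From mathcomp Require Import all_boot all_classical topology separation_axioms.

Set Implicit Arguments.
Unset Strict Implicit.
Unset Printing Implicit Defensive.

Local Open Scope classical_set_scope.

Definition open_cover (X : topologicalType) (U : set (set X)) :=
  U `<=` open /\ \bigcup_(A in U) A = [set: X].

Definition has_countable_subcover (X : topologicalType) (U : set (set X)) :=
  exists V : set (set X),
    [/\ V `<=` U, countable V & \bigcup_(A in V) A = [set: X]].

Definition lindelof (X : topologicalType) :=
  forall U : set (set X), open_cover U -> has_countable_subcover U.

Definition linearly_lindelof (X : topologicalType) :=
  forall U : set (set X), open_cover U -> total_on U subset ->
    has_countable_subcover U.

Definition weakly_lindelof (X : topologicalType) :=
  forall U : set (set X), open_cover U ->
    exists V : set (set X),
      [/\ V `<=` U, countable V & dense (\bigcup_(A in V) A)].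

Definition discrete_space (X : topologicalType) := forall A : set X, open A.

(* Subspaces are taken on [set_type], whose topology is the one induced by the
   inclusion; the alias [subspace L] of the library would instead add every
   point outside [L] as an isolated point. *)
Definition almost_discretely_lindelof (X : topologicalType) :=
  forall D : set X, discrete_space (set_type D) ->
    exists L : set X, lindelof (set_type L) /\ D `<=` L.

(* [open_nbhs x U] means that [U] is open and contains [x]. The operator [O] is
   total, but nothing is required of it on other pairs [x], [U]. *)
Definition monotonically_normal (X : topologicalType) :=
  exists O : X -> set X -> set X,
    (forall (x : X) (U : set X), open_nbhs x U ->
       open_nbhs x (O x U) /\ O x U `<=` U) /\
    (forall (x y : X) (U V : set X), open_nbhs x U -> open_nbhs y V ->
       O x U `&` O y V !=set0 -> V x \/ U y).

(* Main.v *)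
Require Import Defs.
From mathcomp Require Import all_boot all_classical wochoice.
From mathcomp Require Import topology separation_axioms.

(** Let [O] be the operator of monotone normality, and let [N] assign to each
    point a neighbourhood. Two facts about [O] carry the proof.

    - The closure of [\bigcup_(a in A) O a (N a)] lies in
      [\bigcup_(a in A) N a `|` closure A] ([closure_bigcup_O]).
    - If [D] is dense in a closed set [C], then [C] is covered by the sets
      [N z] where [z] ranges over a family of points of [C] indexed by
      [bool * D * D] ([dense_subcover]). In particular, separable closed sets
      are Lindelof.

    A weakly Lindelof [X] is then Lindelof: if countably many sets [O a (N a)]
    have a dense union, then [X] is covered by the corresponding [N a] and by
    the closure of a countable set. In the same way the closure of a Lindelof
    set is Lindelof.

    The other two hypotheses both give the Lindelof property for covers that
    increase along a well-order ([wo_lindelof]). Linear Lindelofness does so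
    at once. For almost discrete Lindelofness, every assignment [N] admits a
    discrete set [J] such that [X] is the union of the closure of [J] and of
    the sets [N x], [x] in [J]; since [J] is contained in a Lindelof set, its
    closure is Lindelof, and if each [N x] is the first member of the
    increasing cover that contains [x], then the members that cover the closure
    of [J] also cover all the [N x].

    It remains to pass from well-ordered covers to arbitrary ones, where the
    obstruction would be a minimal cover of countable cofinality. Two
    inductions along one well-order of [X] remove it. The first
    ([lindelof_set_of_refinement]) shows that a closed set [C] is Lindelof as
    soon as each assignment [N] on it admits a set [A] with Lindelof closure
    such that the sets [O a (N a)], [a] in [A], cover [C]: if the members of a
    cover are grouped into countably many initial segments [S], the points [a]
    whose [N a] belongs to [S] give the closed set
    [closure (\bigcup_a O a (N a))], which up to the Lindelof set [closure A]
    is covered by [S] alone, so that induction applies to it. The second shows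
    that the closures of larger and larger subsets of [X], and finally [X]
    itself, are Lindelof: [dense_subcover] yields a cover of the closure of a
    set in terms of the set, and [wo_lindelof] cuts this cover down to one
    coming from countably many earlier stages. *)

Set Implicit Arguments.
Unset Strict Implicit.
Unset Printing Implicit Defensive.

Local Open Scope classical_set_scope.

(** * Well-orders *)

Definition wo (T : Type) (R : T -> T -> Prop) :=
  [/\ forall x, R x x,
      forall x y, R x y -> R y x -> x = y,
      forall y x z, R x y -> R y z -> R x z &
      forall A : set T, A !=set0 -> exists2 m, A m & forall x, A x -> R m x].

Lemma exists_wo (T : eqType) : exists R : T -> T -> Prop, wo R.
Proof.
have [R Rwo] := well_ordering_principle T.
have Rwo' : wo_chain R predT by move=> A _; exact: Rwo.
have Rtot x y : R x y || R y x by exact: (wo_chainW Rwo').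
have Ranti x y : R x y -> R y x -> x = y.
  by move=> xy yx; apply: (wo_chain_antisymmetric Rwo') => //; rewrite xy yx.
have least (A : set T) : A !=set0 -> exists2 m, A m & forall x, A x -> R m x.
  case=> a Aa; have [|m [[Am mA] _]] := Rwo [pred x | `[< A x >]].
    by exists a; apply/asboolP.
  by exists m => [|x Ax]; [apply/asboolP | apply: mA; apply/asboolP].
have Rrefl x : R x x by move: (Rtot x x); rewrite orbb.
exists R; split=> // y x z xy yz.
have [|m] := least [set w | [\/ w = x, w = y | w = z]].
  by exists x; constructor.
case=> -> mA; first by apply: mA; constructor.
- by have <- : y = x by apply: Ranti => //; apply: mA; constructor.
- by have -> : z = y by apply: Ranti => //; apply: mA; constructor.
Qed.

Lemma wo_total (T : Type) (R : T -> T -> Prop) (Rwo : wo R) x y :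
  R x y \/ R y x.
Proof.
have [_ _ _ least] := Rwo.
have [|m] := least [set w | w = x \/ w = y]; first by exists x; left.
by case=> -> mA; [left|right]; apply: mA; [right|left].
Qed.

Lemma wo_ind (T : Type) (R : T -> T -> Prop) (Rwo : wo R) (P : T -> Prop) :
  (forall t, (forall s, R s t -> s <> t -> P s) -> P t) -> forall t, P t.
Proof.
have [Rrefl Ranti _ least] := Rwo; move=> IH t; apply: contrapT => nPt.
have [|m nPm mP] := least [set t | ~ P t]; first by exists t.
apply: nPm; apply: IH => s sm neq; apply: contrapT => nPs.
by apply: neq; apply: Ranti => //; apply: mP.
Qed.

(** * Lindelof sets and neighbourhood assignments *)

Lemma countable_section (T U : Type) (f : T -> U) (D : set T) (V : set U) :
  countable V -> V `<=` f @` D ->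
  exists A, [/\ A `<=` D, countable A & V `<=` f @` A].
Proof.
move=> cV VD; have [[x0 Dx0]|nD] := pselect (D !=set0); last first.
  exists set0; split=> // v /VD [x Dx _].
  by case: nD; exists x.
have /choice[g gP] (v : U) : exists x, D x /\ (V v -> f x = v).
  have [/VD[x Dx fx]|nVv] := pselect (V v); first by exists x.
  by exists x0.
exists (g @` V); split.
- by move=> _ [v _ <-]; case: (gP v).
- by apply: sub_countable cV; exact: card_image_le.
- by move=> v Vv; exists (g v); [exact: imageP | exact: (gP v).2].
Qed.

Lemma countable_choice (I T : Type) (D : set I) (P : I -> set T -> Prop) :
  countable D -> (forall i, D i -> exists2 A, countable A & P i A) ->
  exists2 F : I -> set T, countable (\bigcup_(i in D) F i) &
    forall i, D i -> P i (F i).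
Proof.
move=> cD h.
have /choice[F FP] i : exists A, D i -> countable A /\ P i A.
  have [/h[A cA PA]|nD] := pselect (D i); first by exists A.
  by exists set0.
exists F; first by apply: bigcup_countable => // i /FP[].
by move=> i /FP[].
Qed.

Section Lindelof_sets.
Context (X : topologicalType).
Implicit Types (A B C D H K L : set X) (N M : X -> set X).

Definition nbhd_assignment L N := forall x, L x -> open_nbhs x (N x).

(** Lindelofness of a subset, in terms of the topology of [X]. Covers are
    replaced by neighbourhood assignments because the operator of monotone
    normality acts on pairs of a point and a neighbourhood. *)
Definition lindelof_set L := forall N, nbhd_assignment L N ->
  exists A, [/\ A `<=` L, countable A & L `<=` \bigcup_(a in A) N a].

Lemma lindelof_setT : lindelof_set [set: X] -> lindelof X.
Proof.
move=> LX U [Uop Ucov].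
have /choice[N NP] (x : X) : exists V, U V /\ V x.
  by have : [set: X] x by []; rewrite -Ucov => -[V UV Vx]; exists V.
have [x _|A [_ cA AX]] := LX N.
  by split; [apply: Uop; case: (NP x) | case: (NP x)].
exists (N @` A); split.
- by move=> _ [x _ <-]; case: (NP x).
- by apply: sub_countable cA; exact: card_image_le.
- rewrite -subTset => x /AX [a Aa Nax]; exists (N a) => //; exact: imageP.
Qed.

Lemma lindelof_set_type L : lindelof (set_type L) -> lindelof_set L.
Proof.
move=> LL N NL.
have [|V [VU cV VL]] :=
    LL [set W | exists2 x, L x & W = (@set_val X L) @^-1` (N x)].
  split=> [_ [x Lx ->]|].
    by exists (N x) => //; case: (NL x Lx).
  rewrite -subTset => x _; exists (set_val @^-1` (N (set_val x))).
    by exists (set_val x) => //; exact: set_valP.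
  by case: (NL (set_val x)) => //; exact: set_valP.
have VU' : V `<=` (fun x => @set_val X L @^-1` (N x)) @` L.
  by move=> W /VU [x Lx ->]; exists x.
have [A [AL cA VA]] := countable_section cV VU'.
exists A; split=> // x Lx.
have : [set: set_type L] (SigSub (mem_set Lx)) by [].
rewrite -VL => -[W /VA [a Aa <-]] Nax.
by exists a.
Qed.

Lemma lindelof_set_bigcup (I : Type) (D : set I) (F : I -> set X) :
  countable D -> (forall i, D i -> lindelof_set (F i)) ->
  lindelof_set (\bigcup_(i in D) F i).
Proof.
move=> cD FL N NF.
have [|G cG GP] := @countable_choice _ X D
  (fun i A => A `<=` F i /\ F i `<=` \bigcup_(a in A) N a) cD.
  move=> i Di; have [|A [? ? ?]] := FL i Di N; last by exists A.
  by move=> x Fx; apply: NF; exists i.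
exists (\bigcup_(i in D) G i); split=> //.
- by move=> x [i Di Gx]; exists i => //; exact: (GP i Di).1.
- move=> x [i Di /(GP i Di).2 [a Ga Nax]].
  by exists a => //; exists i.
Qed.

Lemma lindelof_set_closed L C : closed C -> C `<=` L -> lindelof_set L ->
  lindelof_set C.
Proof.
move=> Ccl CL LL N NC.
have [|A [AL cA LA]] := LL (fun x => if `[< C x >] then N x else ~` C).
  move=> x Lx; case: asboolP => [/NC//|nC].
  by split=> //; exact: closed_openC.
exists (A `&` C); split; first by move=> x [].
- by apply: sub_countable cA; apply: subset_card_le => x [].
- move=> x Cx; have [a Aa] := LA x (CL x Cx).
  by case: asboolP => // Ca Nax; exists a.
Qed.

End Lindelof_sets.

(** * Consequences of monotone normality *)

Section Monotonically_normal.
Context (X : topologicalType) (T1 : accessible_space X).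
Context (O : X -> set X -> set X).
Context (O_nbhs : forall x U, open_nbhs x U ->
  open_nbhs x (O x U) /\ O x U `<=` U).
Context (O_sep : forall x y U V, open_nbhs x U -> open_nbhs y V ->
  O x U `&` O y V !=set0 -> V x \/ U y).
Implicit Types (A B C D H K L : set X) (N M : X -> set X).

Lemma nbhd_assignment_O C N : nbhd_assignment C N ->
  nbhd_assignment C (fun x => O x (N x)).
Proof. by move=> NC x /NC /O_nbhs[]. Qed.

Lemma closure_meets A (x : X) U : closure A x -> open_nbhs x U ->
  A `&` U !=set0.
Proof. by move=> Ax [Uop Ux]; apply: Ax; exact: open_nbhs_nbhs. Qed.

Lemma open_nbhs_setC_closure A (x : X) : ~ closure A x ->
  open_nbhs x (~` closure A).
Proof. by move=> nAx; split=> //; exact/closed_openC/closed_closure. Qed.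

(** A point [y] outside the right-hand side has the neighbourhood
    [~` closure A], which contains no [a], while no [N a] contains [y]; so
    [O y (~` closure A)] misses every [O a (N a)]. *)
Lemma closure_bigcup_O A N : nbhd_assignment A N ->
  closure (\bigcup_(a in A) O a (N a)) `<=` \bigcup_(a in A) N a `|` closure A.
Proof.
move=> NA y yO; apply: contrapT => /not_orP[nN nA].
have yA := open_nbhs_setC_closure nA.
have [w [[a Aa Oaw] Oyw]] := closure_meets yO (O_nbhs yA).1.
have [|nAa|Nay] := O_sep (NA a Aa) yA; first by exists w.
- exact/nAa/subset_closure.
- by apply: nN; exists a.
Qed.

Lemma closure_O x N : open_nbhs x (N x) -> closure (O x (N x)) `<=` N x.
Proof.
move=> Nx y Oy.
have [|||] := @closure_bigcup_O [set x] N _ y; rewrite ?bigcup_set1 //.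
  by move=> _ ->.
have /closure_id <- : closed [set x] by exact: accessible_closed_set1.
by move=> ->; case: Nx.
Qed.

(** Call [z] a point over [a] when [a] belongs to [O z V] for some
    neighbourhood [V] of [z] inside [N z]. The witness [phi true a a'] is a
    point over both [a] and [a'], if there is one. Let [F] be the set of points
    that these witnesses fail to cover; [phi false a a'] is a point [p] of [F]
    such that [a] is in [O p (O p (N p))], if there is one.

    For [q] in [F], density gives an [a] in [D] with [a] in [O q (O q (N q))],
    so that [p] exists. The witnesses [w] over [a] all lie in [O p (N p)]
    because [p] is outside [N w]. Moreover [q] is in their closure: otherwise
    [D] has a point [a'] in [O q V], with [V] a neighbourhood of [q] inside
    [N q] and disjoint from them; then [q] is over [a] and [a'], and the witness
    [w] for [a], [a'] satisfies [q \in N w] or [w \in V], both impossible.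
    Hence [q] is in the closure of [O p (N p)], thus in [N p]. *)
Lemma dense_subcover D N (c : X) : D c -> nbhd_assignment (closure D) N ->
  exists phi : bool -> X -> X -> X,
    (forall b a a', closure D (phi b a a')) /\
    closure D `<=` \bigcup_(b in [set: bool]) \bigcup_(a in D) \bigcup_(a' in D)
      N (phi b a a').
Proof.
move=> Dc ND.
pose Z a := [set z | closure D z /\ exists V,
  [/\ open_nbhs z V, V `<=` N z & O z V a]].
have DcD : closure D c by exact: subset_closure.
have /choice[z zP] (aa : X * X) : exists z, closure D z /\
    ((exists w, Z aa.1 w /\ Z aa.2 w) -> Z aa.1 z /\ Z aa.2 z).
  have [[w [Zw Zw']]|nw] := pselect (exists w, Z aa.1 w /\ Z aa.2 w).
    by exists w; split=> //; case: Zw.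
  by exists c.
pose A := [set z (a, a') | a in D & a' in D].
pose F := closure D `\` \bigcup_(x in A) N x.
have /choice[p pP] (a : X) : exists p, closure D p /\
    ((exists w, F w /\ O w (O w (N w)) a) -> F p /\ O p (O p (N p)) a).
  have [[w [Fw Ow]]|nw] := pselect (exists w, F w /\ O w (O w (N w)) a).
    by exists w; split=> //; case: Fw.
  by exists c.
have AD x : A x -> closure D x by case=> a _ [a' _ <-]; case: (zP (a, a')).
exists (fun b a a' => if b then z (a, a') else p a); split.
  by move=> [] a a'; [case: (zP (a, a')) | case: (pP a)].
move=> q Dq.
have [[_ [a Da [a' Da' <-]] Nq]|nq] := pselect ((\bigcup_(x in A) N x) q).
  by exists true => //; exists a => //; exists a'.
have Fq : F q by [].
have OOq := (O_nbhs (O_nbhs (ND q Dq)).1).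
have [a [Da OOqa]] := closure_meets Dq OOq.1.
have [Dp [|Fp OOpa]] := pP a; first by exists q.
exists false => //; exists a => //; exists c => //.
have Np := ND _ Dp.
apply: (closure_O Np).
have ZO : Z a `&` A `<=` O (p a) (N (p a)).
  move=> w [[Dw [V [Vw VN OV]]] Aw].
  have [|//|Vp] := O_sep Vw (O_nbhs Np).1; first by exists a.
  by case: Fp => _ []; exists w => //; exact: VN.
apply: (closureS ZO); apply: contrapT => nZq.
have W := open_nbhsI (ND q Dq) (open_nbhs_setC_closure nZq).
have [a' [Da' Wa']] := closure_meets Dq (O_nbhs W).1.
have Zq : Z a q.
  split=> //; exists (N q); split=> //; first exact: ND.
  exact: (O_nbhs (O_nbhs (ND q Dq)).1).2.
have Zq' : Z a' q.
  by split=> //; exists (N q `&` ~` closure (Z a `&` A)); split=> // x [].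
have [Dz [|Zz [_ [V [Vz VN OV]]]]] := zP (a, a'); first by exists q.
have Az : A (z (a, a')) by exists a => //; exists a'.
have [|[_ nz]|Vq] := O_sep Vz W; first by exists a'.
- by apply: nz; apply: subset_closure.
- by apply: nq; exists (z (a, a')) => //; exact: VN.
Qed.

Lemma countable_lindelof_closure D : countable D -> lindelof_set (closure D).
Proof.
move=> cD N ND; have [[c Dc]|D0] := pselect (D !=set0); last first.
  exists set0; split=> // x Dx.
  have [d [Dd _]] := closure_meets Dx (ND x Dx).
  by case: D0; exists d.
have [phi [phiD phiN]] := dense_subcover Dc ND.
exists (\bigcup_(b in [set: bool]) \bigcup_(a in D) \bigcup_(a' in D)
  [set phi b a a']); split.
- by move=> _ [b _ [a _ [a' _ ->]]].
- apply: bigcup_countable => [|b _]; first exact: countableP.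
  by do 2![apply: bigcup_countable => // ? _]; exact: countable1.
- move=> x /phiN[b _ [a Da [a' Da' Nx]]]; exists (phi b a a') => //.
  by exists b => //; exists a => //; exists a'.
Qed.

(** The common part of the weakly Lindelof case and of [lindelof_closure]: what
    the sets [N a] miss lies in the closure of a countable set. *)
Lemma countable_subcover_of_dense L A N : closed L -> nbhd_assignment L N ->
  A `<=` L -> countable A -> L `<=` closure (\bigcup_(a in A) O a (N a)) ->
  exists B, [/\ B `<=` L, countable B & L `<=` \bigcup_(b in B) N b].
Proof.
move=> Lcl NL AL cA Ldense.
have clAL : closure A `<=` L by apply: subset_trans Lcl; exact: closureS.
have [B [BA cB AB]] :=
  countable_lindelof_closure cA (fun x Ax => NL x (clAL x Ax)).
exists (A `|` B); split.
- by move=> x [/AL|/BA/clAL].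
- rewrite -bigcup2E; apply: bigcup_countable => // -[|[|n]] _ //=.
- move=> x /Ldense /closure_bigcup_O[a /AL /NL//|[a Aa Nx]|/AB[b Bb Nx]].
  + by exists a => //; left.
  + by exists b => //; right.
Qed.

Lemma lindelof_closure K : lindelof_set K -> lindelof_set (closure K).
Proof.
move=> KL N NK.
have NK' : nbhd_assignment K N by move=> x /subset_closure /NK.
have [A [AK cA KA]] := KL _ (nbhd_assignment_O NK').
apply: (@countable_subcover_of_dense _ A) => //; first exact: closed_closure.
- by move=> x /AK /subset_closure.
- exact: closureS.
Qed.

Lemma weakly_lindelof_setT : weakly_lindelof X -> lindelof_set [set: X].
Proof.
move=> WX N NX.
have OX := nbhd_assignment_O NX.
have [|V [VU cV Vdense]] := WX [set O x (N x) | x in [set: X]].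
  split=> [_ [x _ <-]|]; first by case: (OX x).
  by rewrite -subTset => x _; exists (O x (N x)); [exact: imageP | case: (OX x)].
have [A [_ cA VA]] := countable_section cV VU.
apply: (@countable_subcover_of_dense _ A) => // x _ B; rewrite nbhsE => -[U Ux UB].
have [|y [Uy [W /VA[a Aa <-] Oay]]] := Vdense U _ Ux.1; first by exists x; case: Ux.
by exists y; split; [exists a | exact: UB].
Qed.

(** * Covers increasing along a well-order *)

Context (R : X -> X -> Prop) (Rwo : wo R).

Definition wo_lindelof := forall (Om : X -> set X) H (V : set X),
  (forall t, open (Om t)) -> (forall s t, R s t -> Om s `<=` Om t) ->
  closed H -> H `<=` \bigcup_(t in V) Om t ->
  exists W, [/\ W `<=` V, countable W & H `<=` \bigcup_(t in W) Om t].

Lemma linearly_lindelof_wo : linearly_lindelof X -> wo_lindelof.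
Proof.
move=> LX Om H V Om_op Om_mono Hcl HV.
have [[v Vv]|V0] := pselect (V !=set0); last first.
  by exists set0; split=> // x /HV[t Vt]; case: V0; exists t.
have [| |U [UV cU UX]] := LX [set Om t `|` ~` H | t in V].
- split=> [_ [t _ <-]|]; first exact/openU/closed_openC.
  rewrite -subTset => x _; have [/HV[t Vt Ox]|nHx] := pselect (H x).
    by exists (Om t `|` ~` H); [exact: imageP | left].
  by exists (Om v `|` ~` H); [exact: imageP | right].
- move=> _ _ [s Vs <-] [t Vt <-].
  by have [/Om_mono|/Om_mono] := wo_total Rwo s t; [left|right]; exact: setSU.
have [W [WV cW UW]] := countable_section cU UV.
exists W; split=> // x Hx.
have : [set: X] x by [].
by rewrite -UX => -[Y /UW[t Wt <-] [Ox|//]]; exists t.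
Qed.

(** The set [J] consists of the centres of a maximal disjoint family of sets
    [O x V] with [V] inside [N x]. If [q] were outside the right-hand side, then
    [O q V] with [V = N q `&` ~` closure J] could be added to the family. *)
Lemma discrete_kernel N : nbhd_assignment [set: X] N ->
  exists J, discrete_space (set_type J) /\
    [set: X] `<=` closure J `|` \bigcup_(x in J) N x.
Proof.
move=> NX.
pose D := [set xW : X * set X | open_nbhs xW.1 xW.2 /\ xW.2 `<=` N xW.1].
pose F (xW : X * set X) := O xW.1 xW.2.
have [E [ED Edisj Emax]] := ex_maximal_disjoint_subcollection F D.
exists (fst @` E); split=> [A|q _].
  exists (\bigcup_(xW in [set xW | E xW /\ exists2 j, A j & set_val j = xW.1]) F xW).
    apply: bigcup_open => xW [/ED[xWnb _] _].
    exact: (O_nbhs xWnb).1.1.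
  rewrite predeqE => j; split=> [[xW [ExW [i Ai ix]] Fj]|Aj].
    have [yV EyV yj] : exists2 yV, E yV & yV.1 = set_val j.
      by have [yV] := set_valP j; exists yV.
    suff <- : i = j by [].
    suff : set_val i = set_val j by exact: val_inj.
    rewrite ix -yj; congr fst; apply: Edisj => //; exists (set_val j); split=> //.
    rewrite /F -yj; exact: (O_nbhs (ED _ EyV).1).1.2.
  have [yV EyV yj] : exists2 yV, E yV & yV.1 = set_val j.
      by have [yV] := set_valP j; exists yV.
  exists yV; first by split=> //; exists j.
  rewrite /F -yj; exact: (O_nbhs (ED _ EyV).1).1.2.
apply: contrapT => /not_orP[nJ nN].
have W := open_nbhsI (NX q I) (open_nbhs_setC_closure nJ).
pose qW := (q, N q `&` ~` closure (fst @` E)).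
have DqW : D qW by split=> // x [].
have nE : ~ E qW by move=> EqW; apply: nJ; apply: subset_closure; exists qW.
have key xW : E xW -> ~ (F xW `&` F qW !=set0).
  move=> ExW /(O_sep (ED _ ExW).1 W)[[_ nx]|xq].
    by apply: nx; apply: subset_closure; exists xW.
  by apply: nN; exists xW.1; [exists xW | exact: (ED _ ExW).2].
apply: (Emax (qW |` E)).
- by split=> [|/(_ qW)]; [exact: subsetUr | move=> h; apply: nE; apply: h; left].
- by move=> xW [->//|/ED].
- move=> i j [->|Ei] [->|Ej] // ij; last exact: Edisj.
  + by case: (key j Ej); rewrite setIC.
  + by case: (key i Ei).
Qed.

(** Apply [discrete_kernel] with [N x] the first member of the cover containing
    [x]. If a member [Om t] contains [x], then [N x] lies in [Om t]; therefore
    members covering [closure J] cover each [N x] with [x] in [J] as well. *)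
Lemma almost_discretely_lindelof_wo : almost_discretely_lindelof X -> wo_lindelof.
Proof.
move=> AX Om H V Om_op Om_mono Hcl HV.
have [_ _ _ least] := Rwo.
have /choice[r rP] x : exists t, H x ->
    [/\ V t, Om t x & forall s, V s -> Om s x -> R t s].
  have [Hx|nHx] := pselect (H x); last by exists x.
  have [|t [Vt Ot] tP] := least [set t | V t /\ Om t x].
    by have [t Vt Ot] := HV x Hx; exists t.
  by exists t => _; split=> // s Vs Os; exact: tP.
pose N x := if `[< H x >] then Om (r x) else ~` H.
have NX : nbhd_assignment [set: X] N.
  move=> x _; rewrite /N; case: asboolP => [/rP[_ Ox _]//|nHx].
  by split=> //; exact: closed_openC.
have [J [Jdisc JX]] := discrete_kernel NX.
have [L [/lindelof_set_type LL JL]] := AX J Jdisc.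
have clJL : lindelof_set (closure J).
  apply: lindelof_set_closed (lindelof_closure LL); first exact: closed_closure.
  exact: closureS.
have [A [AJ cA JA]] := clJL N (fun x _ => NX x I).
exists (r @` (A `&` H)); split.
- by move=> _ [x [_ /rP[? _ _]] <-].
- apply: sub_countable (card_image_le _ _) _.
  by apply: sub_countable cA; apply: subset_card_le => x [].
have sub x : H x -> closure J x -> (\bigcup_(t in r @` (A `&` H)) Om t) x.
  move=> Hx /JA[a Aa]; rewrite /N; case: asboolP => // Ha Ox.
  by exists (r a) => //; exists a.
move=> x Hx; have [//|/(sub _ Hx)//|[j Jj]] := JX x.
rewrite /N; case: asboolP => // Hj Ox.
have [t [a aP <-] Oj] := sub j Hj (subset_closure Jj).
exists (r a); first by exists a.
apply: Om_mono Ox; have [_ _ ] := rP j Hj; apply=> //.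
by case: (rP a aP.2).
Qed.

(** By induction on [t], a closed subset of [C] covered by the [M x] with [x]
    up to [t] has a countable subcover. In the inductive step only countably many
    [t] matter, by [wo_lindelof]. Let [N z] be the first [M x] that contains
    [z]. For each such [t], the points [a] of [Om t] satisfy [N a `<=` Om t],
    so the closure of the union [Q t] of their [O a (N a)] lies in
    [Om t `|` closure A]. Once a countable subcover of [closure A] is removed,
    the induction hypothesis for [t] applies to what remains; and the sets [Q t]
    together cover the given closed set. *)
Lemma lindelof_set_of_refinement C : wo_lindelof -> closed C ->
  (forall N, nbhd_assignment C N -> exists A, [/\ A `<=` C,
     lindelof_set (closure A) & C `<=` \bigcup_(a in A) O a (N a)]) ->
  lindelof_set C.
Proof.
move=> WX Ccl refC M MC; have [Rrefl _ Rtrans least] := Rwo.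
pose Om t := \bigcup_(x in [set x | C x /\ R x t]) M x.
have Om_op t : open (Om t) by apply: bigcup_open => x [/MC[]].
have Om_mono s t : R s t -> Om s `<=` Om t.
  by move=> st x [y [Cy ys] Mx]; exists y => //; split=> //; apply: Rtrans st.
pose small H := exists A, [/\ A `<=` C, countable A & H `<=` \bigcup_(a in A) M a].
have step (V : set X) :
    (forall t, V t -> forall H, closed H -> H `<=` C -> H `<=` Om t -> small H) ->
    forall H, closed H -> H `<=` C -> H `<=` \bigcup_(t in V) Om t -> small H.
  move=> IH H Hcl HC HV.
  have [W [WV cW HW]] := WX Om H V Om_op Om_mono Hcl HV.
  have /choice[r rP] x : exists y, C x ->
      [/\ C y, M y x & forall z, C z -> M z x -> R y z].
    have [Cx|nCx] := pselect (C x); last by exists x.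
    have [|y [Cy My] yP] := least [set y | C y /\ M y x].
      by exists x; split=> //; case: (MC x Cx).
    by exists y => _; split=> // z Cz Mz; exact: yP.
  (* Off [H] the assignment avoids [H], so those points do not help to cover it. *)
  pose N x := if `[< H x >] then M (r x) else ~` H.
  have NC : nbhd_assignment C N.
    move=> x Cx; rewrite /N; case: asboolP => [_|nHx].
      by have [/MC[]] := rP x Cx.
    by split=> //; exact: closed_openC.
  have [A [AC clAL CA]] := refC N NC.
  have clAC : closure A `<=` C by apply: subset_trans Ccl; exact: closureS.
  have [B [BA cB AB]] := clAL M (fun x Ax => MC x (clAC x Ax)).
  pose Q t := \bigcup_(a in [set a | [/\ A a, H a & Om t a]]) O a (N a).
  pose K t := (H `&` closure (Q t)) `\` \bigcup_(b in B) M b.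
  have KOm t : K t `<=` Om t.
    move=> x [[Hx]] /closure_bigcup_O[a [Aa _ _]|[a [Aa Ha [y [Cy yt] Mya]]]|clx].
    - exact/NC/AC.
    - rewrite /N; case: asboolP => // _ Mx _; have [Cra _ ramin] := rP a (HC a Ha).
      exists (r a) => //; split=> //.
      by apply: Rtrans yt; exact: ramin.
    - case; apply: AB; move: clx; apply: closureS.
      by move=> a [].
  have Ksmall t : W t -> small (K t).
    move=> Wt; apply: (IH t (WV t Wt)) => //; last by move=> x [[/HC]].
    apply: closedI; first by apply: closedI => //; exact: closed_closure.
    apply: open_closedC; apply: bigcup_open => b /BA/clAC/MC[] //.
  have [G cG GP] := @countable_choice _ X W
    (fun t G => G `<=` C /\ K t `<=` \bigcup_(a in G) M a) cW
    (fun t Wt => let: ex_intro G (And3 a b c) := Ksmall t Wt in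
       ex_intro2 _ _ G b (conj a c)).
  exists (B `|` \bigcup_(t in W) G t); split.
  - by move=> x [/BA/clAC//|[t /GP[+ _]]]; apply.
  - rewrite -bigcup2E; apply: bigcup_countable => // -[|[|n]] _ //=.
  - move=> x Hx; have [[b Bb Mx]|nB] := pselect ((\bigcup_(b in B) M b) x).
      by exists b => //; left.
    have [a Aa Ox] := CA x (HC x Hx).
    have Nx : N a x by apply: (O_nbhs (NC a (AC a Aa))).2.
    have Ha : H a by move: Nx; rewrite /N; case: asboolP.
    have [t Wt Oa] := HW a Ha.
    have [|g Gg Mx] := (GP t Wt).2 x.
      by split=> //; split=> //; apply: subset_closure; exists a.
    by exists g => //; right; exists t.
have small_Om t H : closed H -> H `<=` C -> H `<=` Om t -> small H.
  move: t H; apply: (wo_ind Rwo) => t IH H Hcl HC HOm.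
  pose H' := H `\` (if `[< C t >] then M t else set0).
  have [| | | |A [AC cA HA]] := step [set s | R s t /\ s <> t] _ H'.
  - by move=> s [st sNt]; exact: IH.
  - apply: closedI => //; apply: open_closedC.
    by case: asboolP => [/MC[]//|_]; exact: open0.
  - by move=> x [/HC].
  - move=> x [/HOm[y [Cy yt] My] nM].
    exists y; last by exists y.
    split=> // ety; move: nM; rewrite -ety; case: asboolP => //.
  have [Ct|nCt] := pselect (C t).
    exists (t |` A); split.
    + by move=> x [->|/AC].
    + rewrite -bigcup2E; apply: bigcup_countable => // -[|[|n]] _ //=.
    + move=> x Hx; have [Mt|nMt] := pselect (M t x); first by exists t => //; left.
      have [|a Aa Ma] := HA x; last by exists a => //; right.
      by split=> //; case: asboolP.
  exists A; split=> // x Hx; apply: HA; split=> //.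
  by case: asboolP => // _ [].
apply: (step setT) => // [t _ H|x Cx]; first exact: small_Om.
by exists x => //; exists x; [split | case: (MC x Cx)].
Qed.

(** * Closing up initial segments under finite sequences *)

Definition seq_in (I : set X) : set (seq X) := [set s | forall x, x \in s -> I x].

(** For infinite [I], this amounts to saying that every set of cardinality at
    most that of [I] has Lindelof closure. Using maps defined on finite sequences builds in
    that pairs of elements of an infinite [I] are no more numerous than its
    elements, so that no cardinal arithmetic is required. *)
Definition lindelof_images I := forall f : seq X -> X,
  lindelof_set (closure (f @` seq_in I)).

(** Finite sequences over [t |` I] are sequences over [I] together with one of
    countably many patterns telling where [t] is inserted. *)
Fixpoint interleave (t : X) (m : seq bool) (s : seq X) : seq X :=
  match m, s with
  | true :: m', _ => t :: interleave t m' s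
  | false :: m', x :: s' => x :: interleave t m' s'
  | _, _ => [::]
  end.

Lemma interleaveP (t : X) I s : seq_in (t |` I) s ->
  exists m, exists2 s', seq_in I s' & interleave t m s' = s.
Proof.
elim: s => [|x s IHs] sI; first by exists [::], [::].
have [y ys|m [s' s'I ms']] := IHs; first by apply: sI; rewrite inE ys orbT.
have [|xt|Ix] := sI x; first by rewrite inE eqxx.
  by exists (true :: m), s' => //=; rewrite ms' xt.
exists (false :: m), (x :: s'); last by rewrite /= ms'.
by move=> y; rewrite inE => /orP[/eqP->//|/s'I].
Qed.

Lemma lindelof_closure_bigcup (I : Type) (D : set I) (F : I -> set X) A :
  countable D -> (forall i, D i -> lindelof_set (closure (F i))) ->
  A `<=` \bigcup_(i in D) F i -> lindelof_set (closure A).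
Proof.
move=> cD FL AF.
apply: lindelof_set_closed (lindelof_closure (lindelof_set_bigcup cD FL)).
  exact: closed_closure.
apply: closureS => x /AF[i Di Fx]; exists i => //; exact: subset_closure.
Qed.

Lemma lindelof_images_setU1 t I : lindelof_images I ->
  lindelof_images (t |` I).
Proof.
move=> imagesI f; apply: (@lindelof_closure_bigcup _ [set: seq bool]
  (fun m => (f \o interleave t m) @` seq_in I)); first exact: countableP.
- by move=> m _; exact: imagesI.
- by move=> _ [s /interleaveP[m [s' s'I <-]] <-]; exists m => //; exists s'.
Qed.

(** Let [D] be the image of the sequences in [V]. By [dense_subcover], every
    assignment on [closure D] has a subcover indexed by pairs of such sequences.
    A pair of sequences is contained in some [[set x | R x t]], so this subcover
    is an increasing union over [t] in [V]; countably many [t] suffice, and the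
    points coming from each of them have Lindelof closure by hypothesis. This is
    what [lindelof_set_of_refinement] asks for. *)
Lemma lindelof_images_bigcup (V : set X) : wo_lindelof ->
  (forall s t, R s t -> V t -> V s) ->
  (forall t, V t -> lindelof_images [set x | R x t]) -> lindelof_images V.
Proof.
move=> WX Vdown Vimages f; have [Rrefl _ Rtrans _] := Rwo.
have [[v Vv]|V0] := pselect (V !=set0); last first.
  apply: countable_lindelof_closure.
  apply: sub_countable (countable1 (f [::])); apply: subset_card_le.
  move=> _ [s sV <-]; case: s sV => //= x s sV.
  by case: V0; exists x; apply: sV; rewrite inE eqxx.
set D := f @` seq_in V.
have Df : D (f [::]) by exists [::].
have bounded s : seq_in V s -> exists2 t, V t & seq_in [set x | R x t] s.
  elim: s => [|x s IHs] sV; first by exists v.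
  have [y ys|t Vt st] := IHs; first by apply: sV; rewrite inE ys orbT.
  have Vx : V x by apply: sV; rewrite inE eqxx.
  have [xt|tx] := wo_total Rwo x t.
    by exists t => // y; rewrite inE => /orP[/eqP->|/st].
  exists x => // y; rewrite inE => /orP[/eqP-> //|/st yt]; exact: Rtrans tx.
apply: (lindelof_set_of_refinement WX (@closed_closure _ _)) => N ND.
have [phi [phiD phiN]] := dense_subcover Df (nbhd_assignment_O ND).
pose A t := [set x | exists b s s', [/\ seq_in [set x | R x t] s,
  seq_in [set x | R x t] s' & x = phi b (f s) (f s')]].
have [| | | |W [WV cW DW]] := WX (fun t => \bigcup_(a in A t) O a (N a))
    (closure D) V.
- move=> t; apply: bigcup_open => _ [b [s [s' [_ _ ->]]]].
  exact: (nbhd_assignment_O ND (phiD _ _ _)).1.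
- move=> s t st x [_ [b [u [u' [us u's ->]]]] Ox].
  exists (phi b (f u) (f u')) => //; exists b, u, u'; split=> //.
  + by move=> y /us ys; exact: Rtrans st.
  + by move=> y /u's ys; exact: Rtrans st.
- exact: closed_closure.
- move=> x /phiN[b _ [_ [s sV <-] [_ [s' s'V <-] Ox]]].
  have [|t Vt st] := bounded (s ++ s').
    by move=> y; rewrite mem_cat => /orP[/sV|/s'V].
  exists t => //; exists (phi b (f s) (f s')) => //; exists b, s, s'; split=> //.
  + by move=> y ys; apply: st; rewrite mem_cat ys.
  + by move=> y ys; apply: st; rewrite mem_cat ys orbT.
exists (\bigcup_(t in W) A t); split.
- by move=> _ [t _ [b [s [s' [_ _ ->]]]]].
- apply: lindelof_closure_bigcup cW _ (@subset_refl _ _) => t Wt.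
  (* A pair of sequences is coded by its concatenation and a cutting point. *)
  apply: (@lindelof_closure_bigcup _ [set: bool * nat] (fun bn =>
    (fun s => phi bn.1 (f (take bn.2 s)) (f (drop bn.2 s))) @`
      seq_in [set x | R x t])); first exact: countableP.
    by move=> bn _; exact: (Vimages t (WV t Wt)).
  move=> _ [b [s [s' [st s't ->]]]]; exists (b, size s) => //.
  exists (s ++ s'); last by rewrite /= take_size_cat// drop_size_cat.
  by move=> y; rewrite mem_cat => /orP[/st|/s't].
- by move=> x /DW[t Wt [a At Ox]]; exists a => //; exists t.
Qed.

Lemma wo_lindelof_setT : wo_lindelof -> lindelof_set [set: X].
Proof.
move=> WX; have [Rrefl Ranti Rtrans _] := Rwo.
have initial_segment_images : forall t, lindelof_images [set x | R x t].
  apply: (wo_ind Rwo) => t IH.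
  have -> : [set x | R x t] = t |` [set x | R x t /\ x <> t].
    rewrite predeqE => x; split=> [xt|[->//|[]//]].
    by have [|xNt] := pselect (x = t); [left|right].
  apply: lindelof_images_setU1.
  apply: lindelof_images_bigcup => // [s u su [ut uNt]|s [st sNt]].
    split; first exact: Rtrans ut.
    by move=> st; apply: uNt; apply: Ranti => //; rewrite -st.
  exact: IH.
have [[x0 _]|X0] := pselect ([set: X] !=set0); last first.
  by move=> N _; exists set0; split=> // x; case: X0; exists x.
have imagesX : lindelof_images [set: X] by apply: lindelof_images_bigcup.
apply: lindelof_set_closed (imagesX (head x0)); first exact: closedT.
by move=> x _; apply: subset_closure; exists [:: x].
Qed.

End Monotonically_normal.

Theorem corollary3p18 (X : topologicalType) (T1 : accessible_space X)
    (mnX : monotonically_normal X) :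
  weakly_lindelof X \/ linearly_lindelof X \/ almost_discretely_lindelof X ->
  lindelof X.
Proof.
have [O [O_nbhs O_sep]] := mnX; have [R Rwo] := exists_wo X.
move=> hX; apply: lindelof_setT.
case: hX => [WX|[LX|AX]].
- exact: (weakly_lindelof_setT T1 O_nbhs O_sep).
- apply: (wo_lindelof_setT T1 O_nbhs O_sep Rwo).
  exact: linearly_lindelof_wo.
- apply: (wo_lindelof_setT T1 O_nbhs O_sep Rwo).
  exact: (almost_discretely_lindelof_wo T1 O_nbhs O_sep Rwo).
Qed.
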